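(* Let $G=(V,A)$ be a flow graph with start vertex $s$, let $F$ be a depth-first spanning tree of $G$ rooted at $s$ with vertices identified with their preorder numbers $1,\dots,n$, and let $f(v)$ be the parent of $v$ in $F$. For each $v\neq s$ let $\mathit{sd}(v)$, $\mathit{rd}(v)$ and $g(v)$ be as defined below. Process the vertices $v\neq s$ in increasing order: if $\mathit{sd}(v)=\mathit{sd}(\mathit{rd}(v))$ or $b(\mathit{rd}(v))=f(\mathit{rd}(v))$, set $b(v)=g(v)$ and $r(v)=f(v)$; otherwise set $b(v)=f(v)$ and $r(v)=g(v)$. Let $B$ (resp. $R$) be the graph with vertex set $V$ and arcs $(b(v),v)$ (resp. $(r(v),v)$) for $v\neq s$ (these are spanning trees rooted at $s$). Then $B$ and $R$ are independent: for every vertex $v$, the path in $B$ from $s$ to $v$ and the path in $R$ from $s$ to $v$ have in common only vertices that dominate $v$.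
   Context: A flow graph is a finite directed graph $G=(V,A)$ with start vertex $s$ such that every vertex is reachable from $s$; there are no arcs entering $s$ and $n=|V|>1$. A vertex $u$ dominates $v$ if every path from $s$ to $v$ contains $u$. A path from $u$ to $v$ is high if all its vertices other than $u$ and $v$ are greater (in the preorder numbering of $F$) than both $u$ and $v$. For $v\neq s$, the semi-dominator $\mathit{sd}(v)$ is the minimum vertex $u$ such that there is a high path from $u$ to $v$. For $v\neq s$, $F(\mathit{sd}(v),v]$ denotes the path in $F$ from the child of $\mathit{sd}(v)$ that is an ancestor of $v$ down to $v$; the relative dominator $\mathit{rd}(v)$ is the vertex $x$ on $F(\mathit{sd}(v),v]$ with $\mathit{sd}(x)$ minimum, ties broken in favor of the smallest $x$. For each $v\neq s$, $(g(v),v)\in A$ is an arc that is the last arc on some high path from $\mathit{sd}(v)$ to $v$. *)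

(* Defs.v *)
From mathcomp Require Import all_boot.

Set Implicit Arguments.
Unset Strict Implicit.
Unset Printing Implicit Defensive.

Section Graphs.

Variable V : finType.
Implicit Types (e T : rel V) (s u v w x y : V) (p q o : seq V).

(* Paths are simple; u :: p is the vertex sequence.  Simplicity matters for
   [last_arc_of_high_path]: otherwise a cycle through v could be appended to a
   high path to v without affecting highness. *)
Definition path_from_to e u v p :=
  [/\ path e u p, last u p = v & uniq (u :: p)].

Definition flow_graph e s :=
  [/\ 1 < #|V|, (forall u, ~~ e u s) &
      forall v, exists p, path_from_to e s v p].

Definition dominates e s u v :=
  forall p, path_from_to e s v p -> u \in s :: p.

Definition spanning_tree e s T :=
  [/\ subrel T e,
      (forall u, ~~ T u s),
      (forall v, v != s -> exists! u, T u v) &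
      (forall v, exists p, path_from_to T s v p)].

Definition independent e s T1 T2 :=
  forall v p q, path_from_to T1 s v p -> path_from_to T2 s v q ->
  forall x, x \in s :: p -> x \in s :: q -> dominates e s x v.

Definition parent_graph s (h : V -> V) : rel V :=
  [rel u v | (v != s) && (u == h v)].

(* The states of a depth-first search: o lists the vertices reached so far, in
   the order in which they were reached (i.e. in preorder), and f v is the
   vertex from which v was reached.  The search always advances from the most
   recently reached vertex that still has an arc to an unreached vertex. *)
Inductive dfs e s (f : V -> V) : seq V -> Prop :=
| dfs_start : dfs e s f [:: s]
| dfs_advance o v of
    dfs e s f o & v \notin o & f v \in o & e (f v) v &
    (forall u w, u \in o -> index (f v) o < index u o -> e u w -> w \in o) :
    dfs e s f (rcons o v).

Definition dfs_spanning_tree e s f o := dfs e s f o /\ forall v, v \in o.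

Definition preorder o v := (index v o).+1.

(* In what follows, num is a vertex numbering (the preorder of the tree). *)

Definition high_path e (num : V -> nat) u v p :=
  path_from_to e u v p /\
  forall x, x \in u :: p -> x != u -> x != v ->
    (num u < num x) && (num v < num x).

Definition is_semidominator e (num : V -> nat) v u :=
  (exists p, high_path e num u v p) /\
  forall w, (exists p, high_path e num w v p) -> num u <= num w.

Definition ancestor s (f : V -> V) u v := connect (parent_graph s f) u v.

(* x lies on F(u, v], where F is the tree with parent function f; c is the
   child of u at which that path starts. *)
Definition on_tree_path s (f : V -> V) u v x :=
  exists c, [/\ parent_graph s f u c, ancestor s f c x & ancestor s f x v].

Definition is_relative_dominator s f (num : V -> nat) (sd : V -> V) v x :=
  on_tree_path s f (sd v) v x /\
  forall y, on_tree_path s f (sd v) v y ->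
    (num (sd x) < num (sd y)) || (sd x == sd y) && (num x <= num y).

Definition last_arc_of_high_path e (num : V -> nat) u v w :=
  e w v /\ exists p, high_path e num u v (rcons p v) /\ last u p = w.

Definition update (h : V -> V) v y : V -> V :=
  fun x => if x == v then y else h x.

Definition br_step (f sd rd g : V -> V) (br : (V -> V) * (V -> V)) v :=
  let: (b, r) := br in
  if (sd v == sd (rd v)) || (b (rd v) == f (rd v))
  then (update b v (g v), update r v (f v))
  else (update b v (f v), update r v (g v)).

(* The initial values (here the identity) are irrelevant: every v != s gets
   assigned, and b (rd v) is consulted before rd v has been assigned only when
   rd v = v, in which case the first disjunct of the test is true. *)
Definition br_trees s o f sd rd g : (V -> V) * (V -> V) :=
  foldl (br_step f sd rd g) (id, id) [seq v <- o | v != s].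

End Graphs.

(* Main.v *)
Require Import Defs.
From mathcomp Require Import all_boot zify.

(* Write num for preorder numbers.  For a vertex v and a number a, let
   minlow v a be the least num (sd u) over the ancestors u of v with num u > a,
   capped at a.  Starting from a = num (sd v) and iterating minlow v climbs along
   v, rd v, rd (rd v), ..., and b v = g v exactly when the number of steps is
   even.  Counting the steps so that the count stays monotone in a (a fixed
   point a counts for 2a) gives height v a.

   Each descendant v of a vertex c gets the label
   label c v = height c (minlow v (num c)), and labels restrict along the tree
   by label c v = min (label c c') (label c' v) when c' lies between c and v.
   For each of the two parities k, comparing the labels of two vertices at
   their nearest common ancestor defines a partial order precedes k: labels of
   parity k come first, in increasing order, then those of the other parity, in
   decreasing order.  The tree B (k even) and the tree R (k odd) go down in
   their respective orders, so both are acyclic.  A vertex t precedes v in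
   both orders only when t is an ancestor of v with minlow v (num t) = num t;
   then no semidominator on the tree path from t to v lies above t, so t
   dominates v. *)

Set Implicit Arguments.
Unset Strict Implicit.
Unset Printing Implicit Defensive.

(** * Counting the steps of an iterated descent on natural numbers *)

Section Depth.

(* The number of steps in which m descends from a to a fixed point c, plus 2c;
   the term 2c is even and makes the count monotone in a. *)
Fixpoint depth_rec (m : nat -> nat) k a :=
  if k is k'.+1 then
    if m a < a then (depth_rec m k' (m a)).+1 else a.*2
  else 0.

Definition depth m a := depth_rec m a.+1 a.

(** The fuel is immaterial once it exceeds [a], since each recursive call strictly lowers the
    argument. *)
Lemma depth_recE m k a : a < k -> depth_rec m k a = depth m a.
Proof.
rewrite /depth; elim: k {-2}k (leqnn k) a => [|K IH] [|k] //= kK a ak.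
case: ifP => // ma; rewrite IH //; last by lia.
by rewrite [in RHS](IH a) //; lia.
Qed.

Lemma depthE m a : depth m a = if m a < a then (depth m (m a)).+1 else a.*2.
Proof. by rewrite {1}/depth /=; case: ifP => // ma; rewrite depth_recE. Qed.

Lemma depth_step m a : m a < a -> depth m a = (depth m (m a)).+1.
Proof. by move=> ma; rewrite depthE ma. Qed.

Lemma depth_fix m a : m a = a -> depth m a = a.*2.
Proof. by move=> ma; rewrite depthE ma ltnn. Qed.

Lemma depth_le_double m a : depth m a <= a.*2.
Proof.
elim/ltn_ind: a => a IH; rewrite depthE; case: ifP => // ma.
by have := IH _ ma; lia.
Qed.

Lemma depth_mono m a b : {homo m : x y / x <= y} -> a <= b ->
  depth m a <= depth m b.
Proof.
move=> mm; elim/ltn_ind: b a => b IH a ab.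
rewrite [depth m b]depthE; case: ifP => mb; last first.
  by have := depth_le_double m a; lia.
case: (ltnP (m a) a) => [ma|am].
  by rewrite depth_step // ltnS; apply: IH => //; apply: mm.
(* Here [a <= m a <= m b], so the induction compares [a] with [m b]. *)
by rewrite ltnW // ltnS; apply: IH => //; have := mm _ _ ab; lia.
Qed.

Lemma eq_depth m m' a : (forall x, m x <= x) ->
  (forall x, x <= a -> m x = m' x) -> depth m a = depth m' a.
Proof.
move=> mle; elim/ltn_ind: a => a IH mm'; rewrite depthE [RHS]depthE -mm' //.
case: ifP => // ma; congr _.+1; apply: IH => // x xma.
by apply: mm'; lia.
Qed.

End Depth.

(** * Comparing natural numbers by size and parity *)

Section ParityOrder.

Variable k : bool.

(* Numbers of parity k in increasing order, then the others in decreasing order. *)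
Definition parity_lt m n := (m < n) && (odd m == k) || (n < m) && (odd n != k).

Lemma parity_lt_trans : transitive parity_lt.
Proof. by rewrite /parity_lt => l m n; case: k; lia. Qed.

Lemma parity_lt_asym m n : parity_lt m n -> parity_lt n m -> False.
Proof. by rewrite /parity_lt; case: k; lia. Qed.

(** The parity of the smaller number decides the comparison, and capping either preserves that
    number or makes both equal. *)
Lemma parity_lt_min e m n : parity_lt m n ->
  minn e m = minn e n \/ parity_lt (minn e m) (minn e n).
Proof. by rewrite /parity_lt; case: k; lia. Qed.

Lemma parity_lt_min_inv e m n : parity_lt (minn e m) (minn e n) -> parity_lt m n.
Proof. by rewrite /parity_lt; case: k; lia. Qed.

End ParityOrder.

(** * Vertex labels and the two partial orders on a numbered tree *)

Section TreeOrder.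

Variables (V : finType) (anc : rel V) (num low : V -> nat) (s : V).
Hypothesis anc_refl : reflexive anc.
Hypothesis anc_trans : transitive anc.
Hypothesis anc_num : forall u v, anc u v -> num u <= num v.
Hypothesis num_inj : injective num.
Hypothesis anc_interval :
  forall u w x, anc u w -> num u <= num x -> num x <= num w -> anc u x.
Hypothesis anc_root : forall v, anc s v.

Implicit Types u v w x y t c : V.

Lemma anc_linear u v w : anc u w -> anc v w -> num u <= num v -> anc u v.
Proof. by move=> uw vw uv; apply: anc_interval uw uv (anc_num vw). Qed.

Lemma anc_neq_num u v : anc u v -> u != v -> num u < num v.
Proof.
by move=> uv; rewrite ltn_neqAle (anc_num uv) andbT; apply: contra_neq; apply: num_inj.
Qed.

Definition nca v t := [arg max_(c > s | anc c v && anc c t) num c].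

Lemma ncaP v t : [/\ anc (nca v t) v, anc (nca v t) t &
  forall u, anc u v -> anc u t -> anc u (nca v t)].
Proof.
rewrite /nca; case: arg_maxnP => [|c /andP[cv ct] cmax]; first by rewrite !anc_root.
by split=> // u uv ut; apply: (anc_linear uv cv); apply: cmax; rewrite uv.
Qed.

Lemma nca_eq v t c : anc c v -> anc c t ->
  (forall u, anc u v -> anc u t -> num u <= num c) -> nca v t = c.
Proof.
move=> cv ct cmax; have [nv nt nmax] := ncaP v t.
by apply: num_inj; apply/eqP; rewrite eqn_leq cmax // anc_num // nmax.
Qed.

Lemma ncaC v t : nca v t = nca t v.
Proof.
have [cv ct cmax] := ncaP v t.
by rewrite [RHS](nca_eq ct cv) // => u ut uv; apply/anc_num/cmax.
Qed.

Lemma nca_anc c v : anc c v -> nca v c = c.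
Proof. by move=> cv; apply: nca_eq => // u _ /anc_num. Qed.

Definition minlow v a := \big[minn/a]_(u | anc u v && (a < num u)) low u.

Lemma minlow_le v a : minlow v a <= a.
Proof.
rewrite /minlow; elim/big_rec: _ => // u x _ xa.
by apply: leq_trans xa; apply: geq_minr.
Qed.

Lemma minlow_le_low v a u : anc u v -> a < num u -> minlow v a <= low u.
Proof.
move=> uv au; rewrite /minlow; have := mem_index_enum u.
elim: (index_enum V) => // w r IH; rewrite inE big_cons => /orP[/eqP <-|/IH le].
  by rewrite uv au geq_minl.
by case: ifP => // _; apply: leq_trans le; apply: geq_minr.
Qed.

Lemma le_minlow v a b : b <= a ->
  (forall u, anc u v -> a < num u -> b <= low u) -> b <= minlow v a.
Proof.
move=> ba H; rewrite /minlow; elim/big_rec: _ => // u x /andP[uv au] bx.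
by rewrite leq_min bx H.
Qed.

Lemma minlow_mono v : {homo minlow v : a b / a <= b}.
Proof.
move=> a b ab; apply: le_minlow; first exact: leq_trans (minlow_le _ _) ab.
by move=> u uv bu; apply: minlow_le_low => //; apply: leq_ltn_trans bu.
Qed.

Lemma minlow_self v : minlow v (num v) = num v.
Proof.
apply/eqP; rewrite eqn_leq minlow_le le_minlow // => u /anc_num.
by rewrite leqNgt => /negP.
Qed.

(** An ancestor of [v] numbered at most [num c] is an ancestor of [c]; the others are those that
    [minlow v (num c)] ranges over. *)
Lemma minlow_split c v a : anc c v -> a <= num c ->
  minlow v a = minn (minlow c a) (minlow v (num c)).
Proof.
move=> cv ac; apply/eqP; rewrite eqn_leq; apply/andP; split; last first.
  apply: le_minlow => [|u uv au].
    by apply: leq_trans (geq_minl _ _) (minlow_le _ _).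
  case: (leqP (num u) (num c)) => uc.
    apply: leq_trans (geq_minl _ _) (minlow_le_low _ au).
    exact: anc_linear uv cv uc.
  exact: leq_trans (geq_minr _ _) (minlow_le_low uv uc).
rewrite leq_min minlow_mono // andbT; apply: le_minlow; first exact: minlow_le.
by move=> u uc au; apply: minlow_le_low => //; apply: anc_trans cv.
Qed.

Definition height v := depth (minlow v).

(** By [minlow_split], the ancestors of [v] beyond [c] cannot lower a value that is at most
    [minlow v (num c)]. *)
Lemma height_anc c v a : anc c v -> a <= minlow v (num c) -> height v a = height c a.
Proof.
move=> cv ale; apply: eq_depth => [x|x xa]; first exact: minlow_le.
have mc := minlow_le v (num c); have mx := minlow_le c x.
by rewrite (minlow_split cv); lia.
Qed.

Lemma height_mono v a b : a <= b -> height v a <= height v b.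
Proof. by apply: depth_mono; apply: minlow_mono. Qed.

Definition label c v := height c (minlow v (num c)).

Lemma label_self c : label c c = (num c).*2.
Proof. by rewrite /label minlow_self /height depth_fix // minlow_self. Qed.

Lemma label_le c v : label c v <= (num c).*2.
Proof.
by have := depth_le_double (minlow c) (minlow v (num c));
   have := minlow_le v (num c); rewrite /label /height; lia.
Qed.

Lemma label_split c c' v : anc c c' -> anc c' v ->
  label c v = minn (label c c') (label c' v).
Proof.
move=> cc' c'v; have lec := anc_num cc'.
rewrite /label (minlow_split c'v lec).
set mu := minlow c' (num c); set al := minlow v (num c').
(* The smaller of [mu] and [al] determines [label c v]. There the heights at [c] and [c'] agree, and
   monotonicity bounds the other label. *)
case: (leqP mu al) => [le|lt].
  have : height c mu <= height c' al.
    by rewrite -(height_anc cc') //; apply: height_mono.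
  by lia.
rewrite (height_anc cc' (ltnW lt)).
by have := height_mono c (ltnW lt); lia.
Qed.

(* When the labels tie, t comes first if it is an ancestor of v; otherwise the
   later vertex comes first, which is the direction of the arcs (g v, v). *)
Definition precedes k t v :=
  let c := nca v t in
  parity_lt k (label c t) (label c v) ||
  (label c t == label c v) &&
    ((t == c) || [&& v != c, odd (label c v) == k & num v < num t]).

Lemma precedes_antisym k : antisymmetric (precedes k).
Proof.
move=> t v /andP[]; rewrite /precedes [nca t v]ncaC; set c := nca v t.
case/orP=> [tv|/andP[/eqP tv H]].
  case/orP=> [/(parity_lt_asym tv)//|/andP[/eqP E _]].
  by move: tv; rewrite E /parity_lt ltnn.
case/orP=> [|/andP[_]].
  by rewrite tv /parity_lt ltnn.
case/orP: H => [/eqP->|/and3P[vc _ lt]].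
  by case/orP=> [/eqP->//|/and3P[/eqP]].
by rewrite (negPf vc) => /and3P[_ _]; lia.
Qed.

(** The descendants of [c] occupy an interval of numbers, so [t] is on one side of all of them. *)
Lemma num_branch c v y t : anc c v -> anc c y -> ~~ anc c t ->
  num v < num t -> num y < num t.
Proof.
move=> cv cy ct vt; rewrite ltnNge; apply: contra ct => ty.
by apply: anc_interval cy _ ty; apply: leq_trans (anc_num cv) (ltnW vt).
Qed.

(** Seen from [c], both labels are capped by the same [label c (nca v t)], so [parity_lt_min]
    applies. *)
Lemma label_nca_below k c t v : anc c (nca v t) -> precedes k t v ->
  label c t = label c v \/ parity_lt k (label c t) (label c v).
Proof.
rewrite /precedes; set c' := nca v t; have [cv ct _] := ncaP v t.
rewrite -/c' in cv ct => cc'.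
rewrite (label_split cc' ct) (label_split cc' cv).
case/orP=> [|/andP[/eqP-> _]]; last by left.
exact: parity_lt_min.
Qed.

(** Of the three nearest common ancestors two coincide and the third lies at or below them; the
    cases tell which one that is. *)
Lemma precedes_trans k : transitive (precedes k).
Proof.
move=> y t v ty yv.
have [c1v c1y c1max] := ncaP v y; have [c2y c2t c2max] := ncaP y t.
have [c3v c3t c3max] := ncaP v t.
case: (ltngtP (num (nca v y)) (num (nca y t))) => c12.
- have E : nca v t = nca v y.
    apply: nca_eq => //; first by apply: anc_trans c2t; apply: anc_linear c1y c2y (ltnW c12).
    move=> u uv ut; have [|] := leqP (num u) (num (nca y t)) => uc2.
      by apply/anc_num/c1max => //; apply: anc_trans c2y; apply: anc_linear ut c2t uc2.
    rewrite leqNgt; apply/negP=> _; move: (c12); rewrite ltnNge => /negP[].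
    by apply/anc_num/c1max => //; apply: anc_trans uv; apply: anc_linear c2t ut (ltnW uc2).
  have c1c2 := anc_linear c1y c2y (ltnW c12).
  have nc2v : ~~ anc (nca y t) v.
    by apply/negP=> c2v; have := anc_num (c1max _ c2v c2y); rewrite leqNgt c12.
  have yc : y != nca v y.
    by apply/eqP=> /(congr1 num) E'; move: c12; rewrite -E' ltnNge (anc_num c2y).
  move: (label_nca_below c1c2 ty) yv; rewrite {2}/precedes /precedes E.
  case=> [->|lt]; last first.
    by case/orP=> [/(parity_lt_trans lt)->//|/andP[/eqP<- _]]; rewrite lt.
  case/orP=> [->//|/andP[->]]; rewrite (negPf yc) /= => /and3P[-> -> vy] /=.
  apply/orP; right; apply/orP; right.
  rewrite ltnNge; apply/negP => tv.
  have tv' : num t < num v.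
    rewrite ltn_neqAle tv andbT; apply: contraNneq nc2v => /num_inj <-.
    exact: c2t.
  by have := ltn_trans vy (num_branch c2t c2y nc2v tv'); rewrite ltnn.
- have E : nca v t = nca y t.
    apply: nca_eq => //; first by apply: anc_trans c1v; apply: anc_linear c2y c1y (ltnW c12).
    move=> u uv ut; have [|] := leqP (num u) (num (nca v y)) => uc1.
      by apply/anc_num/c2max => //; apply: anc_trans c1y; apply: anc_linear uv c1v uc1.
    rewrite leqNgt; apply/negP=> _; move: (c12); rewrite ltnNge => /negP[].
    by apply/anc_num/c2max => //; apply: anc_trans ut; apply: anc_linear c1v uv (ltnW uc1).
  have c2c1 := anc_linear c2y c1y (ltnW c12).
  have nc1t : ~~ anc (nca v y) t.
    by apply/negP=> c1t; have := anc_num (c2max _ c1y c1t); rewrite leqNgt c12.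
  have vc : v != nca y t.
    by apply/eqP=> /(congr1 num) E'; move: c12; rewrite -E' ltnNge (anc_num c1v).
  move: (label_nca_below c2c1 yv) ty; rewrite {2}/precedes /precedes E.
  case=> [->|lt]; last first.
    by case/orP=> [/parity_lt_trans->//|/andP[/eqP-> _]]; rewrite lt.
  case/orP=> [->//|/andP[->]] /orP[->|]; first by rewrite orbT.
  case/and3P=> _ -> yt; rewrite vc (num_branch c1y c1v nc1t yt) /=.
  by rewrite !orbT.
move/num_inj: c12 => c12; move: yv ty; rewrite /precedes -c12.
set c := nca v y in c1v c1y c1max c12 *; rewrite -c12 in c2y c2t c2max.
have cc3 := c3max _ c1v c2t.
have [E yv ty|ne] := eqVneq c (nca v t).
  rewrite -E; case/orP: yv => [yv|/andP[/eqP yv H]].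
    case/orP: ty => [/parity_lt_trans->//|/andP[/eqP-> _]]; first by rewrite yv.
  case/orP: ty => [|/andP[/eqP ty H']]; first by rewrite yv => ->.
  rewrite ty yv eqxx; apply/orP; right=> /=.
  case/orP: H' => [->//|/and3P[yc o yt]].
  move: H; rewrite (negPf yc) => /= /and3P[-> -> vy] /=.
  by rewrite (ltn_trans vy yt) orbT.
have cn := anc_neq_num cc3 ne.
have vc : v != c by apply/eqP=> /(congr1 num) E; move: cn; rewrite -E ltnNge (anc_num c3v).
have tc : t != c by apply/eqP=> /(congr1 num) E; move: cn; rewrite -E ltnNge (anc_num c3t).
have nc3y : ~~ anc (nca v t) y.
  by apply/negP=> c3y; have := anc_num (c1max _ c3v c3y); rewrite leqNgt cn.
move=> yv ty.
(* The labels at [c] are those at [nca v t] capped by a common value, so a strict comparison at [c]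
   already holds at [nca v t]. *)
suff : parity_lt k (label c t) (label c v).
  by rewrite (label_split cc3 c3t) (label_split cc3 c3v) => /parity_lt_min_inv ->.
case/orP: yv => [yv|/andP[/eqP yv H]].
  by case/orP: ty => [/parity_lt_trans->//|/andP[/eqP-> _]].
case/orP: ty => [|/andP[/eqP ty]]; first by rewrite yv.
(* Two ties would put [y] between [v] and [t] in number, although it lies outside the subtree of
   [nca v t]. *)
rewrite (negPf tc) /= => /and3P[yc _ yt]; move: H; rewrite (negPf yc) /=.
case/and3P=> _ _ vy; have := ltn_trans yt (num_branch c3v c3t nc3y vy); by rewrite ltnn.
Qed.

(** Strict comparisons for the two parities exclude each other, and so do the tie-breaks by number;
    what remains is a tie of labels with [t] equal to [nca v t]. *)
Lemma precedes_both t v : precedes false t v -> precedes true t v ->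
  anc t v /\ minlow v (num t) = num t.
Proof.
rewrite /precedes; have [cv ct _] := ncaP v t; set c := nca v t in cv ct *.
case/orP=> [H|/andP[/eqP E H]].
  case/orP=> [H'|/andP[/eqP E _]]; last by move: H; rewrite E /parity_lt ltnn.
  by move: H H'; rewrite /parity_lt; lia.
case/orP; first by rewrite E /parity_lt ltnn.
case/andP=> _ H'; have tc : t = c.
  case/orP: H => [/eqP//|/and3P[_ o _]]; case/orP: H' => [/eqP//|/and3P[_ o' _]].
  by move: o o'; case: odd.
split; first by rewrite tc.
(* The label of [v] at [t] is at most twice [minlow v (num t)], yet it equals twice [num t]. *)
apply/eqP; rewrite eqn_leq minlow_le leqNgt; apply/negP=> lt.
have := depth_le_double (minlow c) (minlow v (num c)).
by move: E; rewrite tc label_self /label /height -tc; lia.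
Qed.

(** Since [v] alone lies beyond [p], its label at [p] is [height v (low v)], unless it ties with the
    maximal label, that of [p]. Being smaller and of the other parity, it comes later. *)
Lemma precedes_parent k p v : anc p v -> num p < num v ->
  (forall u, anc u v -> num p < num u -> u = v) -> low v <= num p ->
  odd (height v (low v)) != k -> precedes k p v.
Proof.
move=> pv ltp only lowp o; rewrite /precedes nca_anc // label_self eqxx.
have m : minlow v (num p) = low v.
  apply/eqP; rewrite eqn_leq minlow_le_low //=; apply: le_minlow => // u uv pu.
  by rewrite (only u).
have := label_le p v; rewrite leq_eqVlt => /orP[/eqP->|lt].
  by rewrite eqxx orbT.
by rewrite /parity_lt lt /= {2}/label m -(height_anc pv) ?m // o orbT.
Qed.

(** Unless the labels tie, the label of [v] at [a] is one step short of [height v (low v)], hence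
    not of parity [k], and comes after the maximal label of [a]. *)
Lemma precedes_low k a v : anc a v -> num a = low v ->
  odd (height v (low v)) = k -> precedes k a v.
Proof.
move=> av ea o; rewrite /precedes nca_anc // label_self eqxx /=.
have := minlow_le v (num a); rewrite leq_eqVlt => /orP[/eqP E|lt].
  by rewrite /label E /height depth_fix ?minlow_self // eqxx orbT.
have := label_le a v; rewrite leq_eqVlt => /orP[/eqP->|ltl]; first by rewrite eqxx orbT.
rewrite /parity_lt ltl /= /label -(height_anc av) //.
move: o; rewrite -ea /height depth_step //= => <-.
by case: (odd (depth _ _)); rewrite !orbT.
Qed.

(** Serves the arcs entering [v] from a later vertex. At [c] the label of [w] is [height c (low v)];
    the first descent step from [low v] at [v] relates it to the label of [v]. *)
Lemma precedes_cross k w v (c := nca v w) :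
  num v < num w -> low v < num v -> low v <= num c ->
  minlow w (num c) = low v -> odd (height v (low v)) = k -> precedes k w v.
Proof.
move=> vw lowv lec mw o; have [cv cw _] := ncaP v w.
rewrite -/c in cv cw; rewrite /precedes -/c.
have wl : label c w = height c (low v) by rewrite /label mw.
have [cE|cn] := eqVneq v c.
  rewrite wl -cE label_self /parity_lt o eqxx andbT.
  have := depth_le_double (minlow v) (low v); rewrite -/(height v (low v)).
  by move=> le; rewrite (_ : _ < _); last lia.
have cvn : num c < num v by apply: anc_neq_num; rewrite // eq_sym.
set S := low v in lowv lec mw o wl *; set al := minlow v (num c).
have alS : al <= S by apply: minlow_le_low.
have vl : label c v = height c al by [].
have vl' : height v al = height c al by apply: height_anc.
rewrite wl vl vw /= andbT.
have mono : height c al <= height c S by apply: height_mono.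
have mS : minlow v S = minn (minlow c S) al by apply: minlow_split.
have mcS := minlow_le c S.
have hE : forall u a, minlow u a < a -> height u a = (height u (minlow u a)).+1.
  by move=> u a; apply: depth_step.
(* From [S], the descent at [v] goes to the smaller of [al] and [minlow c S]. *)
case: (leqP al (minlow c S)) => [le|lt].
  have mS' : minlow v S = al by lia.
  (* Equality makes the labels tie, and [num v < num w] decides. Otherwise the label of [v] is one
     less than [height v S], so not of parity [k]. *)
  move: alS; rewrite leq_eqVlt => /orP[/eqP E|ltS].
    move: o; rewrite -E vl' => ->; rewrite !eqxx /=; by rewrite !orbT.
  move: o; rewrite hE mS' // vl' /= => o.
  suff : height c al < height c S by rewrite /parity_lt; move: o; case: (k); lia.
  move: mcS; rewrite leq_eqVlt => /orP[/eqP E|ltc].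
    rewrite [X in _ < X]/height depth_fix //.
    by have := depth_le_double (minlow c) al; rewrite -/(height c al); lia.
  by rewrite [X in _ < X]hE // ltnS; apply: height_mono.
(* Now the label of [w] has parity [k], and that of [v] equals it or is one less. *)
have mS' : minlow v S = minlow c S by lia.
have cS : height v S = height c S.
  rewrite hE mS'; last by lia.
  by rewrite [RHS]hE; [rewrite (height_anc cv) //; apply: ltnW | lia].
have : height c S <= (height c al).+1.
  by rewrite hE; [rewrite ltnS; apply/height_mono/ltnW | lia].
by move: o; rewrite cS /parity_lt; case: (k); lia.
Qed.

End TreeOrder.

(** * Ancestors and preorder in a depth-first search *)

Section DepthFirstSearch.

Variables (V : finType) (e : rel V) (s : V) (f : V -> V).
Implicit Types (u v w x : V) (o : seq V).

Local Notation anc := (ancestor s f).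

Lemma ancestor_refl : reflexive anc.
Proof. by move=> v; apply: connect0. Qed.

Lemma ancestor_trans : transitive anc.
Proof. by move=> v u w; apply: connect_trans. Qed.

Lemma ancestor_parent v : v != s -> anc (f v) v.
Proof. by move=> vs; apply: connect1; rewrite /parent_graph /= vs eqxx. Qed.

Lemma ancestorP u v : anc u v -> u = v \/ v != s /\ anc u (f v).
Proof.
case/connectP=> p; case/lastP: p => [_ ->|p x]; first by left.
rewrite rcons_path last_rcons => /andP[pp /andP[xs /eqP xE]] vx; right.
by rewrite vx; split=> //; apply/connectP; exists p; rewrite ?xE.
Qed.

Lemma ancestor_child u v : anc u v -> u != v ->
  exists2 c, parent_graph s f u c & anc c v.
Proof.
case/connectP=> -[|c p] /=; first by move=> _ ->; rewrite eqxx.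
by case/andP=> uc cp -> _; exists c => //; apply/connectP; exists p.
Qed.

Lemma dfs_uniq o : Defs.dfs e s f o -> uniq o.
Proof. by elim=> // o' v _ U vo _ _ _; rewrite rcons_uniq vo. Qed.

Lemma dfs_head o : Defs.dfs e s f o -> exists o', o = s :: o'.
Proof. by elim=> [|o' v _ [l ->] *]; [exists [::] | exists (rcons l v)]. Qed.

Lemma index_rcons_mem o v x : x \in o -> index x (rcons o v) = index x o.
Proof. by move=> xo; rewrite -cats1 index_cat xo. Qed.

Lemma index_rcons_last o v : v \notin o -> index v (rcons o v) = size o.
Proof. by move=> vo; rewrite -cats1 index_cat (negPf vo) /= eqxx addn0. Qed.

Lemma dfs_parent o v : Defs.dfs e s f o -> v \in o -> v != s ->
  [/\ f v \in o, index (f v) o < index v o & e (f v) v].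
Proof.
move=> D; elim: D v => [v|o' w _ IH wo fwo ew _ v].
  by rewrite inE => ->.
rewrite mem_rcons inE => /orP[/eqP->|vo] vs.
  rewrite mem_rcons inE fwo orbT index_rcons_mem // index_rcons_last //.
  by split=> //; rewrite index_mem.
have [fo lt ev] := IH v vo vs.
by rewrite mem_rcons inE fo orbT !index_rcons_mem.
Qed.

Lemma dfs_ancestor o u v : Defs.dfs e s f o -> v \in o -> anc u v ->
  u \in o /\ index u o <= index v o.
Proof.
move=> D; have [m] := ubnP (index v o); elim: m v => // m IH v lt vo.
case/ancestorP=> [->//|[vs uv]].
have [fo ltf _] := dfs_parent D vo vs.
have [|uo le] := IH (f v) _ fo uv; first by apply: leq_trans ltf _.
by split=> //; apply: leq_trans le (ltnW ltf).
Qed.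

Lemma dfs_root o v : Defs.dfs e s f o -> v \in o -> anc s v.
Proof.
move=> D; have [m] := ubnP (index v o); elim: m v => // m IH v lt vo.
have [->|vs] := eqVneq v s; first exact: ancestor_refl.
have [fo ltf _] := dfs_parent D vo vs.
apply: ancestor_trans (ancestor_parent vs); apply: IH fo.
by apply: leq_trans ltf _.
Qed.

(* The vertices that still have an arc to an unreached vertex lie on the
   search stack, that is, they are ancestors of the last vertex reached. *)
Lemma dfs_stack o : Defs.dfs e s f o ->
  [/\ forall u w, u \in o -> e u w -> w \notin o -> anc u (last s o),
      forall u w x, w \in o -> anc u w -> index u o <= index x o ->
        index x o <= index w o -> anc u x &
      forall u w, w \in o -> e u w -> index u o < index w o -> anc u w].
Proof.
elim=> [|o' v D [open intv arcs] vo fvo ev done].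
  split=> [u w|u w x|u w] /=.
  - by rewrite inE => /eqP-> *; apply: ancestor_refl.
  - rewrite inE => /eqP-> us; have [|uo _] := dfs_ancestor (dfs_start e s f) _ us.
      by rewrite inE.
    move: uo; rewrite inE => /eqP->; rewrite eqxx.
    by case: eqP => [<-|] *; first apply: ancestor_refl.
  - by rewrite inE => /eqP->; rewrite eqxx.
have D' : Defs.dfs e s f (rcons o' v) by apply: dfs_advance.
have [l ol] := dfs_head D.
have lasto : last s o' \in o' by rewrite ol /= mem_last.
have vs : v != s by apply: contraNneq vo => ->; rewrite ol inE eqxx.
have fvl := open _ _ fvo ev vo.
have idxl x : x \in o' -> index x o' <= index (last s o') o'.
  move=> xo; have U := dfs_uniq D; move: xo; rewrite -index_mem => lt.
  have -> : index (last s o') o' = (size o').-1.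
    by rewrite -nth_last index_uniq // ol.
  by move: lt; case: (size o').
(* By the advance rule [u] is not later than [f v], so [f v] lies in the interval from [u] to the
   last vertex reached and descends from [u]. *)
have up u w : u \in o' -> e u w -> w \notin o' -> anc u v.
  move=> uo uw wo; apply: ancestor_trans (ancestor_parent vs).
  apply: intv lasto (open _ _ uo uw wo) _ (idxl _ fvo).
  by rewrite leqNgt; apply: contra wo => lt; apply: done uo lt uw.
split=> [u w|u w x|u w].
- rewrite last_rcons !mem_rcons !inE negb_or => /orP[/eqP-> *|uo uw /andP[_]].
    exact: ancestor_refl.
  exact: up.
- rewrite mem_rcons inE => wo uw; have := dfs_ancestor D' _ uw.
  rewrite mem_rcons inE wo => /(_ isT)[_ _].
  have xlt : index x (rcons o' v) <= index w (rcons o' v) ->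
     (x = v) \/ x \in o'.
    move=> le; have : x \in rcons o' v.
      by rewrite -index_mem; apply: leq_ltn_trans le _; rewrite index_mem mem_rcons inE wo.
    by rewrite mem_rcons inE => /orP[/eqP|]; [left|right].
  move=> lux lxw; case: (xlt lxw) => [xv|xo].
    case/orP: wo => [/eqP wv|wo]; first by rewrite xv -wv.
    move: lxw; rewrite xv index_rcons_last // index_rcons_mem // => le.
    by move: wo; rewrite -index_mem ltnNge le.
  have uo : u \in o'.
    rewrite -index_mem; move: lux; rewrite (index_rcons_mem v xo).
    have [//|] := boolP (u \in o'); first by rewrite index_mem.
    rewrite -index_mem -leqNgt => sz.
    rewrite -cats1 index_cat -index_mem ltnNge sz /= => le.
    by move: xo; rewrite -index_mem => /(leq_ltn_trans le); rewrite ltnNge leq_addr.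
  move: lux lxw; rewrite (index_rcons_mem v xo) (index_rcons_mem v uo) => lux.
  case/orP: wo => [/eqP wv _|wo].
    apply: intv lasto _ lux (idxl _ xo); apply: ancestor_trans fvl.
    move: uw; rewrite wv => /ancestorP[uv|[]//].
    by move: vo; rewrite -uv uo.
  by rewrite index_rcons_mem //; apply: intv.
rewrite mem_rcons inE => /orP[/eqP->|wo] uw.
  rewrite index_rcons_last // => lt.
  apply: up uw vo.
  move: lt; rewrite -cats1 index_cat; case: ifP => // _.
  by rewrite ltnNge leq_addr.
rewrite (index_rcons_mem v wo) => lt; apply: arcs => //.
move: lt; rewrite -cats1 index_cat; case: ifP => // _ lt.
by move: wo; rewrite -index_mem => /(ltn_trans lt); rewrite ltnNge leq_addr.
Qed.

End DepthFirstSearch.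

(** * Semidominators, high paths and dominators *)

Section Semidominators.

Variables (V : finType) (e : rel V) (s : V) (f : V -> V) (o : seq V) (sd : V -> V).
Hypothesis F_dfs : dfs_spanning_tree e s f o.
Hypothesis sdP : forall v, v != s -> is_semidominator e (preorder o) v (sd v).

Local Notation anc := (ancestor s f).
Local Notation num := (preorder o).
Local Notation low := (fun v => num (sd v)).

Implicit Types (a b c t u v w x : V) (p : seq V).

Lemma preorder_inj : injective num.
Proof.
move=> u v [E]; have oV := F_dfs.2.
by rewrite -(nth_index s (oV u)) E nth_index.
Qed.

Lemma ancestor_preorder u v : anc u v -> num u <= num v.
Proof. by case/(dfs_ancestor F_dfs.1 (F_dfs.2 v)). Qed.

Lemma ancestor_root v : anc s v.
Proof. exact: dfs_root F_dfs.1 (F_dfs.2 v). Qed.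

Lemma ancestor_interval u w x :
  anc u w -> num u <= num x -> num x <= num w -> anc u x.
Proof.
rewrite /preorder !ltnS; have [_ intv _] := dfs_stack F_dfs.1.
exact: intv (F_dfs.2 w).
Qed.

Lemma ancestor_arc u w : e u w -> num u < num w -> anc u w.
Proof.
rewrite /preorder ltnS; have [_ _ arcs] := dfs_stack F_dfs.1.
exact: arcs (F_dfs.2 w).
Qed.

Lemma preorder_neq u v : u != v -> num u <= num v -> num u < num v.
Proof.
by move=> uv; rewrite ltn_neqAle => ->; rewrite andbT; apply: contra_neq uv; apply: preorder_inj.
Qed.

Lemma preorder_root v : num s <= num v.
Proof. exact/ancestor_preorder/ancestor_root. Qed.

Lemma preorder_parent v : v != s -> num (f v) < num v /\ e (f v) v.
Proof. by case/(dfs_parent F_dfs.1 (F_dfs.2 v)). Qed.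

(** An arc to a larger number leads to a descendant; an arc to a smaller one stays in the interval
    of descendants of [u]. *)
Lemma path_descendants u p : path e u p -> (forall x, x \in p -> num u <= num x) ->
  forall x, x \in u :: p -> anc u x.
Proof.
move=> up ge; suff H : forall c, anc u c -> path e c p -> forall x, x \in c :: p -> anc u x.
  exact: H (ancestor_refl _ _ _) up.
elim: p ge {up} => [|y p IH] ge c uc /=; first by move=> _ x; rewrite inE => /eqP->.
case/andP=> cy yp x; rewrite inE => /orP[/eqP->//|].
apply: IH => // [z zp|]; first by apply: ge; rewrite inE zp orbT.
have uy : num u <= num y by apply: ge; rewrite inE eqxx.
case: (leqP (num y) (num c)) => [yc|/(ancestor_arc cy)]; first exact: ancestor_interval uc uy yc.
exact: ancestor_trans.
Qed.

(** Shortening a walk only drops vertices, so walks may replace simple paths. *)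
Lemma semidominator_le a v p : path e a p -> last a p = v -> v != s ->
  (forall x, x \in p -> x != a -> x != v -> (num a < num x) && (num v < num x)) ->
  num (sd v) <= num a.
Proof.
move=> ap lv vs hi; case/shortenP: ap lv => q aq U sub lv.
apply: (sdP vs).2; exists q; split=> // x; rewrite inE => /orP[/eqP->|xq xa xv].
  by rewrite eqxx.
by apply: hi => //; apply: sub.
Qed.

Lemma semidominator_le_parent v : v != s -> num (sd v) <= num (f v).
Proof.
move=> vs; have [_ ev] := preorder_parent vs.
apply: (@semidominator_le _ _ [:: v]) => //=; first by rewrite ev.
by move=> x; rewrite inE => /eqP-> _; rewrite eqxx.
Qed.

Lemma semidominator_lt v : v != s -> num (sd v) < num v.
Proof.
by move=> vs; apply: leq_ltn_trans (semidominator_le_parent vs) (preorder_parent vs).1.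
Qed.

Lemma high_path_ge v p : v != s -> high_path e num (sd v) v p ->
  forall x, x \in p -> num (sd v) <= num x.
Proof.
move=> vs [_ hi] x xp; have [->//|xs] := eqVneq x (sd v).
have [->|xv] := eqVneq x v; first exact/ltnW/semidominator_lt.
have xp' : x \in sd v :: p by rewrite inE xp orbT.
by have /andP[/ltnW] := hi x xp' xs xv.
Qed.

Lemma semidominator_ancestor v : v != s -> anc (sd v) v.
Proof.
move=> vs; have [[p H] _] := sdP vs; have [[pp lp _] _] := H.
by rewrite -{2}lp; apply: path_descendants pp (high_path_ge vs H) _ (mem_last _ _).
Qed.

(* The witness is the minimum of the path: everything after it descends from
   it, and everything before it is greater than it. *)
Lemma path_crossing a p : path e a p -> p != [::] ->
  (forall x, x \in p -> num a < num x) ->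
  exists2 b, b \in p & anc b (last a p) /\ num (sd b) <= num a.
Proof.
case: p => // y p' ap _ gt; set p := y :: p' in ap gt *.
have yp : y \in p by rewrite inE eqxx.
case: (arg_minnP (P := mem p) num yp) => b bp bmin.
exists b => //; have bs : b != s.
  by apply: contraTneq (gt b bp) => ->; rewrite -leqNgt preorder_root.
case/splitPr: bp ap gt bmin => p1 p2; rewrite cat_path last_cat /=.
case/and3P=> ap1 eb bp2 gt bmin; split.
  apply: path_descendants bp2 _ _ (mem_last _ _) => x xp2.
  by apply: bmin; rewrite /= mem_cat inE xp2 !orbT.
apply: (@semidominator_le _ _ (rcons p1 b)) => //.
- by rewrite rcons_path ap1.
- by rewrite last_rcons.
move=> x; rewrite mem_rcons inE => /orP[/eqP->|xp1]; first by rewrite eqxx.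
have xp : x \in p1 ++ b :: p2 by rewrite mem_cat xp1.
move=> _ xb; rewrite gt //=; apply: preorder_neq; first by rewrite eq_sym.
exact: bmin.
Qed.

(** A path avoiding [t] has a last vertex smaller than [t]. Applied to what follows it,
    [path_crossing] yields an ancestor of [v] beyond [t] with semidominator smaller than [t]. *)
Lemma dominates_of_semidominators t v : anc t v ->
  (forall u, anc u v -> num t < num u -> num t <= num (sd u)) -> dominates e s t v.
Proof.
move=> tv H p [sp lp _]; apply/negPn/negP => tp.
suff K : forall a q, path e a q -> last a q = v -> t \notin a :: q ->
    ~~ has (fun x => num x < num t) (a :: q).
  have := K _ _ sp lp tp; rewrite /= negb_or => /andP[/negP[]]; rewrite preorder_neq ?preorder_root //.
  by apply: contraNneq tp => ->; rewrite inE eqxx.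
move=> a q; elim: q a {p sp lp tp} => [|b q IH] a /=.
  by move=> _ -> _; rewrite orbF -leqNgt ancestor_preorder.
case/andP=> ab bq lq; rewrite inE negb_or => /andP[ta tq].
have /= hq := IH b bq lq tq; rewrite negb_or hq andbT; apply/negP=> lta.
have gt x : x \in b :: q -> num t < num x.
  move=> xq; apply: preorder_neq; first by apply: contraNneq tq => ->.
  by rewrite leqNgt; apply: contra hq => ltx; apply/(@hasP _ (fun x => num x < num t) (b :: q)); exists x.
have [|||c cq [cv sc]] := @path_crossing a (b :: q) => //=.
- by rewrite ab.
- by move=> x /gt; apply: ltn_trans.
rewrite /= lq in cv; have := H c cv (gt c cq).
by rewrite leqNgt (leq_ltn_trans sc lta).
Qed.

(** The two bounds on [sd x] give the value of [minlow w] at the nearest common ancestor of [v] and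
    [w], as [precedes_cross] requires. *)
Lemma last_arc_cases v w : v != s -> last_arc_of_high_path e num (sd v) v w ->
  w = sd v \/ [/\ num v < num w, anc (sd v) w,
    forall x, anc x w -> ~~ anc x v -> num (sd v) <= num (sd x) &
    exists2 x, anc x w && ~~ anc x v & num (sd x) <= num (sd v)].
Proof.
move=> vs [ewv [p [H lp]]]; have [[pp _ U] hi] := H.
have [p0|pn] := eqVneq p [::]; first by left; rewrite -lp p0.
right; have gt x : x \in p -> num v < num x.
  move=> xp; have /andP[//] : (num (sd v) < num x) && (num v < num x).
  apply: hi; first by rewrite inE mem_rcons inE xp !orbT.
  - by move: U; rewrite /= mem_rcons inE negb_or => /andP[/andP[_ +] _]; apply: contraNneq => <-.
  by move: U; rewrite /= rcons_uniq => /and3P[_ + _]; apply: contraNneq => <-.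
move: pp; rewrite rcons_path => /andP[pp _].
have wp : w \in p by rewrite -lp; case: (p) pn => // y q _; rewrite /= mem_last.
split; first exact: gt.
- apply: path_descendants pp _ _ _; last by rewrite inE wp orbT.
  by move=> x xp; apply: high_path_ge vs H _ _; rewrite mem_rcons inE xp orbT.
- move=> x xw nxv; have vx : num v < num x.
    rewrite ltnNge; apply: contra nxv => le.
    exact: ancestor_interval xw le (ltnW (gt w wp)).
  have xs : x != s by apply: contraTneq vx => ->; rewrite -leqNgt preorder_root.
  have [[q [[qp lq _] hq]] _] := sdP xs.
  have sx := semidominator_lt xs.
  case/connectP: xw => r rp lr.
  (* A high path to [x], then the tree path from [x] to [w], then the arc to [v]. *)
  apply: (@semidominator_le _ _ (q ++ rcons r v)) => //.
  + rewrite cat_path qp lq rcons_path -lr ewv andbT /=.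
    apply: sub_path rp => y z /andP[zs /eqP->].
    by have [] := preorder_parent zs.
  + by rewrite last_cat last_rcons.
  move=> y; rewrite mem_cat mem_rcons inE => yqr ysd yv.
  suff xy : num x <= num y by rewrite (leq_trans sx xy) (leq_trans vx xy).
  case/or3P: yqr => [yq|yE|yr]; last 2 first.
  + by rewrite yE in yv.
  + by apply/ancestor_preorder/(path_connect rp); rewrite inE yr orbT.
  have [->//|yx] := eqVneq y x.
  by have /andP[_ /ltnW] := hq y (mem_behead (s := sd x :: q) yq) ysd yx.
have [x xp [xw sx]] := path_crossing pp pn (fun x xp => ltn_trans (semidominator_lt vs) (gt x xp)).
rewrite lp in xw; exists x => //; rewrite xw /=.
by apply: contraTN (gt x xp) => /ancestor_preorder; rewrite -leqNgt.
Qed.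

(** Identifies the tree path with the range of [minlow v (num (sd v))]. *)
Lemma on_tree_pathP v x : v != s ->
  on_tree_path s f (sd v) v x <-> anc x v /\ num (sd v) < num x.
Proof.
move=> vs; split=> [[c [/andP[cs /eqP sc] cx xv]]|[xv lt]].
  split=> //; rewrite sc; apply: leq_trans (preorder_parent cs).1 _.
  exact: ancestor_preorder.
have sx : anc (sd v) x.
  apply: ancestor_interval (semidominator_ancestor vs) (ltnW lt) _.
  exact: ancestor_preorder.
have [|c sc cx] := ancestor_child sx; last by exists c.
by apply: contraTneq lt => ->; rewrite ltnn.
Qed.

End Semidominators.

(** * The two spanning trees and their independence *)

Section IndependentTrees.

Variables (V : finType) (e : rel V) (s : V) (f : V -> V) (o : seq V) (sd rd g : V -> V).
Hypothesis F_dfs : dfs_spanning_tree e s f o.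
Hypothesis sdP : forall v, v != s -> is_semidominator e (preorder o) v (sd v).
Hypothesis rdP :
  forall v, v != s -> is_relative_dominator s f (preorder o) sd v (rd v).
Hypothesis gP :
  forall v, v != s -> last_arc_of_high_path e (preorder o) (sd v) v (g v).

Local Notation anc := (ancestor s f).
Local Notation num := (preorder o).
Local Notation low := (fun v => num (sd v)).
Local Notation minlow := (minlow anc num low).
Local Notation height := (height anc num low).
Local Notation nca := (nca anc num s).
Local Notation precedes := (precedes anc num low s).

Let anc_refl := @ancestor_refl V s f.
Let anc_trans := @ancestor_trans V s f.
Let anc_num := ancestor_preorder F_dfs.
Let num_inj := preorder_inj F_dfs.
Let anc_interval := ancestor_interval F_dfs.
Let anc_root := ancestor_root F_dfs.

Implicit Types (k : bool) (t u v w x : V).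

Lemma relative_dominatorP v (q := rd v) : v != s ->
  [/\ anc q v, num (sd v) < num q, num (sd q) <= num (sd v) &
      forall u, anc u v -> num (sd v) < num u -> num (sd q) <= num (sd u)].
Proof.
move=> vs; have [/(on_tree_pathP F_dfs sdP _ vs)[qv lt] qmin] := rdP vs.
have le u : anc u v -> num (sd v) < num u -> num (sd q) <= num (sd u).
  move=> uv lu; have /qmin := (on_tree_pathP F_dfs sdP u vs).2 (conj uv lu).
  by case/orP=> [/ltnW//|/andP[/eqP<-]].
by split=> //; apply: le => //; apply: semidominator_lt F_dfs sdP _ vs.
Qed.

Definition parity v := odd (height v (low v)).

(** The first descent step goes to [low (rd v)], and from there [height_anc] moves the descent from
    [v] to [rd v]. *)
Lemma parity_rd v : v != s ->
  parity v = (sd v != sd (rd v)) && ~~ parity (rd v).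
Proof.
move=> vs; have [qv lt le qmin] := relative_dominatorP vs.
have m : minlow v (low v) = low (rd v).
  apply/eqP; rewrite eqn_leq minlow_le_low //=.
  exact: le_minlow.
rewrite /parity /height; have [E|ne] := eqVneq (sd v) (sd (rd v)).
  by rewrite depth_fix ?odd_double // m E.
rewrite depth_step m; last by rewrite (preorder_neq F_dfs) // eq_sym.
rewrite -/(height v _) (@height_anc _ _ _ _ anc_trans anc_num anc_interval _ _ _ qv) //.
apply: le_minlow => [|u uv qu]; first exact: leq_trans le (ltnW lt).
exact/qmin/(ltn_trans lt).
Qed.

(** [false] stands for the tree [B] and [true] for [R]. *)
Definition colored_parent k v := if parity v == k then g v else f v.

Lemma colored_parent_arc k v : v != s -> e (colored_parent k v) v.
Proof.
move=> vs; rewrite /colored_parent; case: ifP => _; first by have [] := gP vs.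
by have [] := preorder_parent F_dfs vs.
Qed.

(** Ensures that the test [b (rd v) == f (rd v)] really reads off the parity of [rd v]. *)
Lemma g_neq_f v : v != s -> num (sd v) < num (f v) -> g v != f v.
Proof.
move=> vs lt; apply/eqP=> E; have [gs|[vg _ _ _]] := last_arc_cases F_dfs sdP vs (gP vs).
  by move: lt; rewrite -E gs ltnn.
by have := (preorder_parent F_dfs vs).1; rewrite -E ltnNge (ltnW vg).
Qed.

Lemma precedes_colored_parent k v : v != s -> precedes k (colored_parent k v) v.
Proof.
move=> vs; rewrite /colored_parent; have sv := semidominator_lt F_dfs sdP vs.
have anc_sv := semidominator_ancestor F_dfs sdP vs.
case: eqP => [pk|/eqP npk]; last first.
  have fv := (preorder_parent F_dfs vs).1.
  apply: precedes_parent => //; first exact: ancestor_parent.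
    move=> u uv fu; have [//|[_ /anc_num]] := ancestorP uv.
    by rewrite leqNgt fu.
  exact: semidominator_le_parent F_dfs sdP _ vs.
have [->|[vw sw ge [x /andP[xw xv] lex]]] := last_arc_cases F_dfs sdP vs (gP vs).
  exact: precedes_low.
have [cv cw cmax] := ncaP anc_num anc_interval anc_root v (g v).
have sc := anc_num (cmax _ anc_sv sw).
(* This turns the bounds of [last_arc_cases] into bounds on [minlow (g v)]. *)
have gtc u : anc u (g v) -> (num (nca v (g v)) < num u) = ~~ anc u v.
  move=> uw; rewrite ltnNge; congr (~~ _); apply/idP/idP => [le|uv].
    by apply: anc_trans cv; apply: anc_linear uw cw le.
  exact/anc_num/cmax.
apply: precedes_cross => //; apply/eqP; rewrite eqn_leq; apply/andP; split.
  by apply: leq_trans lex; apply: minlow_le_low => //; rewrite gtc.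
by apply: le_minlow => // u uw; rewrite gtc //; apply: ge.
Qed.

Section ColoredTree.

Variables (k : bool) (h : V -> V).
Hypothesis hE : forall v, v != s -> h v = colored_parent k v.

Lemma connect_precedes t v : connect (parent_graph s h) t v -> precedes k t v.
Proof.
case/connectP=> p; elim: p t => [|u p IH] t /=.
  by move=> _ ->; rewrite /precedes nca_anc // !eqxx orbT.
case/andP=> /andP[us /eqP->] up lv.
apply: precedes_trans (IH _ up lv) => //.
by rewrite hE //; apply: precedes_colored_parent.
Qed.

Lemma colored_parent_neq v : v != s -> h v != v.
Proof.
move=> vs; rewrite hE // /colored_parent; case: ifP => _; last first.
  by apply: contraTneq (preorder_parent F_dfs vs).1 => ->; rewrite ltnn.
have [->|[vg _ _ _]] := last_arc_cases F_dfs sdP vs (gP vs).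
  by apply: contraTneq (semidominator_lt F_dfs sdP vs) => ->; rewrite ltnn.
by apply: contraTneq vg => ->; rewrite ltnn.
Qed.

(** The parent strictly precedes its child, so it has fewer predecessors; induction on their number
    ends at [s]. *)
Lemma colored_connect_root v : connect (parent_graph s h) s v.
Proof.
have [m] := ubnP #|[set t | precedes k t v]|; elim: m v => // m IH v.
rewrite ltnS => cv; have [->|vs] := eqVneq v s; first exact: connect0.
have hv : connect (parent_graph s h) (h v) v.
  by apply: connect1; rewrite /parent_graph /= vs eqxx.
apply: connect_trans (hv); apply: IH; apply: leq_trans cv.
have hp := connect_precedes hv.
apply: proper_card; apply/properP; split.
  apply/subsetP=> t; rewrite !inE => th.
  exact: (precedes_trans anc_trans anc_num num_inj anc_interval anc_root th hp).
exists v; rewrite !inE; first exact/connect_precedes/connect0.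
apply/negP=> vh; have /eqP[] := colored_parent_neq vs.
by apply: (precedes_antisym anc_num num_inj anc_interval anc_root (low := low) (k := k)); rewrite hp vh.
Qed.

Lemma colored_spanning_tree : spanning_tree e s (parent_graph s h).
Proof.
split=> [u v /andP[vs /eqP->]|u|v vs|v].
- by rewrite hE //; apply: colored_parent_arc.
- by rewrite /parent_graph /= eqxx.
- exists (h v); split; first by rewrite /parent_graph /= vs eqxx.
  by move=> u /andP[_ /eqP].
case/connectP: (colored_connect_root v) => p sp ->.
by case/shortenP: sp => q sq U _; exists q.
Qed.

End ColoredTree.

Lemma colored_trees_independent b r :
  (forall v, v != s -> b v = colored_parent false v) ->
  (forall v, v != s -> r v = colored_parent true v) ->
  independent e s (parent_graph s b) (parent_graph s r).
Proof.
move=> bE rE v p q [sp lp _] [sq lq _] x xp xq.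
have conn h l : path (parent_graph s h) s l -> last s l = v -> x \in s :: l ->
    connect (parent_graph s h) x v.
  move=> sl <- xl; case/splitPl: xl sl => l1 l2 <-.
  by rewrite cat_path last_cat => /andP[_ l2p]; apply/connectP; exists l2.
have [||xv mx] := precedes_both anc_num anc_interval anc_root (t := x) (v := v) (low := low).
- exact: (connect_precedes bE (conn _ _ sp lp xp)).
- exact: (connect_precedes rE (conn _ _ sq lq xq)).
apply: (dominates_of_semidominators F_dfs sdP xv) => u uv xu.
by rewrite -{1}mx; apply: minlow_le_low.
Qed.

Lemma br_treesE v : v != s ->
  (br_trees s o f sd rd g).1 v = colored_parent false v /\
  (br_trees s o f sd rd g).2 v = colored_parent true v.
Proof.
(* The invariant concerns the prefix of the preorder processed so far. *)
suff K : forall i, i <= size o -> forall v, v \in take i o -> v != s ->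
    let br := foldl (br_step f sd rd g) (id, id) [seq v <- take i o | v != s] in
    br.1 v = colored_parent false v /\ br.2 v = colored_parent true v.
  by have := K _ (leqnn _) v; rewrite take_size; apply; apply: F_dfs.2.
elim=> [|i IH] lti x; first by rewrite take0.
rewrite (take_nth s lti); set v0 := nth s o i.
rewrite mem_rcons inE filter_rcons => xv xs.
have {}IH := IH (ltnW lti).
have idx : index v0 o = i by rewrite index_uniq // (dfs_uniq F_dfs.1).
have [v0s|v0s] := eqVneq v0 s.
  by rewrite /=; apply: IH => //; case/orP: xv xs => [/eqP->|//]; rewrite v0s eqxx.
rewrite foldl_rcons; set br := foldl _ _ _ in IH *.
case: br IH => b r /= IH.
have -> : (sd v0 == sd (rd v0)) || (b (rd v0) == f (rd v0)) = ~~ parity v0.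
  rewrite parity_rd // negb_and !negbK; case: eqVneq => //= ne.
  have [qv lt le _] := relative_dominatorP v0s.
  have qs : rd v0 != s.
    by apply: contraTneq lt => ->; rewrite -leqNgt; apply: preorder_root F_dfs _.
  have lt' : num (sd (rd v0)) < num (sd v0).
    by rewrite (preorder_neq F_dfs) // eq_sym.
  have qn : rd v0 != v0 by apply: contra_neq ne => ->.
  have qt : rd v0 \in take i o.
    rewrite in_take; last exact: F_dfs.2.
    by rewrite -idx -ltnS; apply: (anc_neq_num anc_num num_inj qv).
  have [-> _] := IH _ qt qs; rewrite /colored_parent.
  case: (parity _) => /=; first by rewrite eqxx.
  (* [sd v0] is a proper ancestor of [rd v0], so [sd (rd v0)] is smaller than [f (rd v0)]. *)
  apply/negbTE/g_neq_f => //; apply: leq_trans lt' _.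
  have [E|[_ sf]] := ancestorP (anc_linear anc_num anc_interval
    (semidominator_ancestor F_dfs sdP v0s) qv (ltnW lt)).
    by move: lt; rewrite -E ltnn.
  exact: anc_num.
case/orP: xv => [/eqP->|xt].
  by rewrite /colored_parent /update; case: (parity v0); rewrite /= eqxx.
have xv0 : x != v0.
  apply: contraTneq xt => ->; rewrite in_take; last exact: F_dfs.2.
  by rewrite idx ltnn.
by have := IH x xt xs; case: (parity v0); rewrite /= /update (negPf xv0).
Qed.

End IndependentTrees.

Theorem theorem38 (V : finType) (e : rel V) (s : V)
    (f : V -> V) (o : seq V) (sd rd g : V -> V)
    (G_flow : flow_graph e s)
    (F_dfs : dfs_spanning_tree e s f o)
    (sdP : forall v : V, v != s -> is_semidominator e (preorder o) v (sd v))
    (rdP : forall v : V, v != s -> is_relative_dominator s f (preorder o) sd v (rd v))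
    (gP : forall v : V, v != s ->
       last_arc_of_high_path e (preorder o) (sd v) v (g v)) :
  let: (b, r) := br_trees s o f sd rd g in
  let B := parent_graph s b in
  let R := parent_graph s r in
  [/\ spanning_tree e s B, spanning_tree e s R & independent e s B R].
Proof.
have := br_treesE F_dfs sdP rdP gP; case: (br_trees _ _ _ _ _ _) => b r /= brE.
have bE v vs := (brE v vs).1; have rE v vs := (brE v vs).2.
split; first exact: (colored_spanning_tree F_dfs sdP gP bE).
  exact: (colored_spanning_tree F_dfs sdP gP rE).
exact: (colored_trees_independent F_dfs sdP gP bE rE).
Qed.
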